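(* The CNF formula $\mathcal F_n$ of \textsc{Sink-or-Clash} has an efficient resolution proof. That is, there are resolution proofs $\mathcal P_n$ of $\mathcal F_n$ ($n\ge 1$) such that, with $N=n2^n$ the number of variables of $\mathcal F_n$, $\log(s(\mathcal P_n))+w(\mathcal P_n)\in\mathrm{polylog}(N)$.
   Context: Let $\mathfrak{C}=\{0,1\}^n$, $[n]=\{1,\dots,n\}$. For each $u\in\mathfrak{C}$ and $i\in[n]$ there is a Boolean variable $x_{u,i}$ (encoding the $i$-th bit of the outmap value at $u$). For distinct $u,v\in\mathfrak{C}$ let $I_{u,v}=\{i\in[n]\mid u_i\ne v_i\}$. The CNF formula of \textsc{Sink-or-Clash} is $$\mathcal F_n=\Big(\bigwedge_{u\in\mathfrak{C}}\bigvee_{i\in[n]}x_{u,i}\Big)\wedge\Big(\bigwedge_{u,v\in\mathfrak{C},\,u\ne v}\ \bigwedge_{o\in\{0,1\}^{I_{u,v}}}\ \bigvee_{i\in I_{u,v}}(x_{u,i}\ne o_i\vee x_{v,i}\ne o_i)\Big),$$ where $x_{u,i}\ne o_i$ stands for the literal $x_{u,i}$ if $o_i=0$ and $\neg x_{u,i}$ if $o_i=1$. (It states that no vertex is a sink and no two distinct vertices clash.) A resolution step derives the clause $C\vee D$ from clauses $C\vee x$ and $D\vee\neg x$, for disjunctive clauses $C,D$ and a literal $x$. A resolution proof of an unsatisfiable CNF formula is a sequence of resolution steps, each using clauses of the formula or clauses derived in earlier steps, ending with the empty clause $\bot$. Its size $s(\mathcal P)$ is the number of resolution steps and its width $w(\mathcal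 P)$ is the largest number of literals in any clause of the proof. A resolution proof $\mathcal P$ of a formula on $N$ variables is efficient if $\log(s(\mathcal P))+w(\mathcal P)\in\mathrm{polylog}(N)$, i.e. is bounded by a fixed polynomial in $\log N$ (uniformly over the family). *)

(* Defs.v *)
From HB Require Import structures.
From mathcomp Require Import all_boot all_order all_algebra.
From mathcomp Require Import reals exp.

Set Implicit Arguments.
Unset Strict Implicit.
Unset Printing Implicit Defensive.

Import Order.TTheory GRing.Theory Num.Theory.

(* (x, true) is the literal x and (x, false) is the literal ~x. *)
Definition literal (V : finType) : finType := (V * bool)%type.
Definition compl_lit (V : finType) (l : literal V) : literal V := (l.1, ~~ l.2).

(* Clauses are sets of literals, read disjunctively; the empty clause is set0.
   CNF formulas are sets of clauses, read conjunctively. *)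
Definition clause (V : finType) : finType := {set literal V}.
Definition cnf (V : finType) : finType := {set clause V}.

Record step (V : finType) := Step {
  lpremise : clause V;
  rpremise : clause V;
  resolvent : clause V
}.

(* In "C \/ x" and "D \/ ~x" the displayed pivot is not repeated in C or D,
   so that resolving really removes it (clauses being sets). *)
Definition resolution_step (V : finType) (st : step V) : Prop :=
  exists (C D : clause V) (x : literal V),
    [/\ x \notin C, compl_lit x \notin D,
        lpremise st = x |: C, rpremise st = compl_lit x |: D
      & resolvent st = C :|: D].

(* F holds the clauses available so far: those of the formula and those
   derived by earlier steps. *)
Fixpoint resolution_derivation (V : finType) (F : cnf V) (P : seq (step V))
    : Prop :=
  if P is st :: P' then
    [/\ lpremise st \in F, rpremise st \in F, resolution_step st
      & resolution_derivation (resolvent st |: F) P']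
  else True.

Definition resolution_proof (V : finType) (F : cnf V) (P : seq (step V))
    : Prop :=
  resolution_derivation F P /\
  exists (P' : seq (step V)) (st : step V),
    P = rcons P' st /\ resolvent st = set0.

Definition proof_size (V : finType) (P : seq (step V)) : nat := size P.

Definition proof_width (V : finType) (P : seq (step V)) : nat :=
  \max_(st <- P) maxn #|lpremise st| (maxn #|rpremise st| #|resolvent st|).

Section Efficiency.
Local Open Scope ring_scope.

Definition log2 (R : realType) (x : R) : R := ln x / ln 2.

(* log s(P_n) + w(P_n) is polylogarithmic in the number #|V n| of variables,
   with one polynomial p for all n >= 1. *)
Definition efficient (R : realType) (V : nat -> finType)
    (P : forall n : nat, seq (step (V n))) : Prop :=
  exists p : {poly R}, forall n : nat, (1 <= n)%N ->
    log2 (proof_size (P n))%:R + (proof_width (P n))%:R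
      <= p.[log2 (#|V n|)%:R].

End Efficiency.

(* The coordinates 1, ..., n are indexed by 'I_n = {0, ..., n - 1}. *)
Definition cube (n : nat) : finType := {ffun 'I_n -> bool}.

(* The pair (u, i) is the variable x_{u,i}. *)
Definition soc_var (n : nat) : finType := (cube n * 'I_n)%type.

Lemma card_soc_var (n : nat) : #|soc_var n| = n * 2 ^ n.
Proof. by rewrite card_prod card_ffun card_bool card_ord mulnC. Qed.

Definition diff (n : nat) (u v : cube n) : {set 'I_n} := [set i | u i != v i].

Definition no_sink_clause (n : nat) (u : cube n) : clause (soc_var n) :=
  [set ((u, i), true) | i : 'I_n].

(* The literal "x_{w,i} <> b". *)
Definition neq_lit (n : nat) (w : cube n) (i : 'I_n) (b : bool)
    : literal (soc_var n) := ((w, i), ~~ b).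

(* o is given on all of 'I_n, but only its restriction to diff u v is used; as
   o ranges over {0,1}^n that restriction ranges over {0,1}^(diff u v). *)
Definition no_clash_clause (n : nat) (u v o : cube n) : clause (soc_var n) :=
  \bigcup_(i in diff u v) [set neq_lit u i (o i); neq_lit v i (o i)].

Definition sink_or_clash (n : nat) : cnf (soc_var n) :=
  [set no_sink_clause u | u : cube n] :|:
  [set C | [exists u : cube n, exists v : cube n, exists o : cube n,
             (u != v) && (C == no_clash_clause u v o)]].

(* Main.v *)
(* Sweeping the coordinates one by one finds a sink of every face while
   remembering few bits.  To find a sink of a (k+1)-face, find a sink v of a
   k-facet; if v is not a sink of the whole face, keep v and find a sink u of
   the opposite facet.  If u is not a sink of the whole face either, then u and
   v clash; otherwise v may be forgotten.  At most k + 1 bits are kept at level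
   k, so, read backwards, the search is a refutation of width at most n (n + 1).
   Deriving no clause twice, a refutation of width W needs at most as many
   steps as there are clauses of width at most W. *)

Require Import Defs.
From mathcomp Require Import all_boot all_order all_algebra.
From mathcomp Require Import boolp reals exp.
From mathcomp Require Import zify lra.

Set Implicit Arguments.
Unset Strict Implicit.
Unset Printing Implicit Defensive.

Import Order.TTheory GRing.Theory Num.Theory.

(** * Resolution of bounded width, and its conversion into short proofs *)

Section BoundedWidth.
Variables (V : finType) (W : nat).
Implicit Types (F : cnf V) (A C : clause V) (st : step V) (P : seq (step V)).

Definition step_width st : nat :=
  maxn #|lpremise st| (maxn #|rpremise st| #|resolvent st|).

(** Derivations are trees here, so subderivations combine freely; [short_resolution_proof] turns
    them into sequences. *)
Inductive derivable F : clause V -> Prop :=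
| derivable_axiom C : C \in F -> derivable F C
| derivable_step st :
    derivable F (lpremise st) -> derivable F (rpremise st) ->
    resolution_step st -> step_width st <= W -> derivable F (resolvent st).

(* Resolution has no weakening rule, so clauses are derived up to subsumption. *)
Definition subsumed F A : Prop := exists2 C : clause V, C \subset A & derivable F C.

Lemma subsumed_sub F A C : C \subset A -> subsumed F C -> subsumed F A.
Proof. by move=> sCA [D sDC derD]; exists D => //; apply: subset_trans sCA. Qed.

Lemma subsumed_axiom F A C : C \in F -> C \subset A -> subsumed F A.
Proof. by move=> FC sCA; exists C => //; apply: derivable_axiom. Qed.

(** A subsuming clause without its pivot literal already lies inside [A]; otherwise the two clauses
    resolve. The strict bound leaves room for the pivot in each premise. *)
Lemma subsumed_resolve F A (x : literal V) : #|A| < W ->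
  subsumed F (x |: A) -> subsumed F (compl_lit x |: A) -> subsumed F A.
Proof.
move=> ltAW [C sC derC] [D sD derD].
have [Cx|nCx] := boolP (x \in C); last first.
  exists C => //; apply/subsetP=> y Cy; move/subsetP/(_ y Cy): sC.
  by rewrite !inE => /predU1P[yx|//]; rewrite -yx Cy in nCx.
have [Dx|nDx] := boolP (compl_lit x \in D); last first.
  exists D => //; apply/subsetP=> y Dy; move/subsetP/(_ y Dy): sD.
  by rewrite !inE => /predU1P[yx|//]; rewrite -yx Dy in nDx.
pose st := Step C D (C :\ x :|: D :\ compl_lit x).
have sR : resolvent st \subset A by rewrite subUset !subDset sC sD.
exists (resolvent st) => //; apply: derivable_step => //.
  exists (C :\ x), (D :\ compl_lit x), x.
  by split; rewrite ?setD11 ?setD1K.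
have width_le (y : literal V) (E : clause V) : E \subset y |: A -> #|E| <= W.
  move=> sE; apply: leq_trans (subset_leq_card sE) _.
  by rewrite cardsU1; case: (y \notin A); lia.
rewrite !geq_max (width_le _ _ sC) (width_le _ _ sD) /=.
exact: leq_trans (subset_leq_card sR) (ltnW ltAW).
Qed.

Definition narrow_clauses : {set clause V} :=
  [set C : clause V | #|C| <= W].

(** A narrow clause is listed in [W] slots, those left over being filled with [None]. *)
Lemma card_narrow_clauses : #|narrow_clauses| <= #|literal V|.+1 ^ W.
Proof.
pose values (f : {ffun 'I_W -> option (literal V)}) : clause V :=
  [set l | Some l \in codom f].
have -> : #|literal V|.+1 ^ W = #|{ffun 'I_W -> option (literal V)}|.
  by rewrite card_ffun card_option card_ord.
rewrite -cardsT; apply: leq_trans (leq_imset_card values _).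
apply/subset_leq_card/subsetP=> C; rewrite inE => leCW.
apply/imsetP; exists [ffun i : 'I_W => nth None (map Some (enum C)) i] => //.
apply/setP=> l; rewrite inE; apply/idP/codomP => [Cl|[i]].
  have ltl : index l (enum C) < W.
    by apply: leq_trans leCW; rewrite cardE index_mem mem_enum.
  exists (Ordinal ltl); rewrite ffunE /= (nth_map l) ?nth_index ?mem_enum //.
  by rewrite index_mem mem_enum.
rewrite ffunE; have [lti|gei] := ltnP i (size (enum C)); last first.
  by rewrite nth_default ?size_map.
by rewrite (nth_map l) // => -[->]; rewrite -mem_enum mem_nth.
Qed.

(** Induction on the number of narrow clauses outside [F]. If no narrow step leaves [F], then [F]
    contains every derivable clause, even [set0]; otherwise such a step adds a new narrow clause. As
    [set0] is not in [F], some step must derive it, and the proof stops there. *)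
Lemma short_resolution_proof F : set0 \notin F -> derivable F set0 ->
  exists2 P, resolution_proof F P &
    size P <= #|narrow_clauses :\: F| /\ proof_width P <= W.
Proof.
have [m] := ubnP #|narrow_clauses :\: F|.
elim: m F => // m IHm F ltm nF0 derF0.
have [[st [Fl Fr st_ok le_st nFst]]|closedF] := pselect (exists st,
    [/\ lpremise st \in F, rpremise st \in F, resolution_step st,
        step_width st <= W & resolvent st \notin F]); last first.
  suff /(_ _ derF0) : forall C, derivable F C -> C \in F by rewrite (negPf nF0).
  move=> C; elim=> [//|st _ Fl _ Fr st_ok le_st].
  by apply: contrapT => /negP nFst; case: closedF; exists st.
have narrow_st : resolvent st \in narrow_clauses :\: F.
  by rewrite !inE nFst; move: le_st; rewrite !geq_max => /and3P[].
have cardF : #|narrow_clauses :\: F|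
    = #|narrow_clauses :\: (resolvent st |: F)|.+1.
  rewrite (cardsD1 (resolvent st)) narrow_st add1n; congr (#|pred_of_set _|.+1).
  by apply/setP=> C; rewrite !inE negb_or andbA.
have [st0|n0st] := eqVneq (resolvent st) set0.
  exists [:: st]; first by split; [split | exists [::], st].
  by rewrite cardF /proof_width big_seq1.
have [|||P [derP [P' [st' [eqP st'0]]]] [sizeP widthP]] :=
    IHm (resolvent st |: F).
- by rewrite cardF in ltm.
- by rewrite !inE negb_or eq_sym n0st.
- elim: derF0 => [C FC|st1 _ derl _ derr st1_ok le_st1].
    by apply: derivable_axiom; rewrite !inE FC orbT.
  exact: derivable_step.
exists (st :: P).
  by split=> //; exists (st :: P'), st'; rewrite eqP.
split; first by rewrite cardF.
by rewrite /proof_width big_cons geq_max le_st.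
Qed.

End BoundedWidth.

(** * The search for a sink, face by face *)

Section SinkSearch.
Variables (n W : nat).
Implicit Types (a u v : cube n) (A : clause (soc_var n)).

(* The falsity of this clause says that v is a sink in the directions < k. *)
Definition low_clause v (k : nat) : clause (soc_var n) :=
  [set ((v, i), true) | i : 'I_n & i < k].

Lemma card_low_clause v k : #|low_clause v k| <= k.
Proof.
apply: leq_trans (leq_imset_card _ _) _.
rewrite cardE -(size_map val) -[leqRHS](size_iota 0).
apply: uniq_leq_size; first by rewrite map_inj_uniq ?enum_uniq //; apply: val_inj.
by move=> _ /mapP[i + ->]; rewrite mem_enum mem_iota inE.
Qed.

Lemma low_clause0 v : low_clause v 0 = set0.
Proof. by apply/setP=> l; rewrite inE; apply/imsetP=> -[i]; rewrite inE. Qed.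

Lemma low_clauseS v (j : 'I_n) :
  low_clause v j.+1 = ((v, j), true) |: low_clause v j.
Proof.
apply/setP=> l; rewrite !inE; apply/imsetP/predU1P => [[i]|[->|/imsetP[i]]].
- rewrite inE ltnS leq_eqVlt => /predU1P[/val_inj->|ltij] ->; first by left.
  by right; apply: imset_f; rewrite inE.
- by exists j => //; rewrite inE ltnS.
- by rewrite inE => ltij ->; exists i => //; rewrite inE ltnS ltnW.
Qed.

Lemma low_clause_no_sink v : low_clause v n = no_sink_clause v.
Proof.
apply/setP=> l; apply/imsetP/imsetP=> -[i _ ->]; exists i => //.
by rewrite inE ltn_ord.
Qed.

Definition flip a (j : 'I_n) : cube n := [ffun i => a i (+) (i == j)].

(** This is the [k]-face through [a] spanned by the directions below [k]. *)
Definition in_face a (k : nat) v : Prop := forall i : 'I_n, k <= i -> v i = a i.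

Lemma clash_sub a (j : 'I_n) u v : in_face a j v -> in_face (flip a j) j u ->
  exists2 C : clause (soc_var n), C \in sink_or_clash n &
    C \subset [set ((u, j), false); ((v, j), false)]
      :|: (low_clause u j :|: low_clause v j).
Proof.
move=> av au.
(* The common outmap value of [u] and [v]: outgoing in direction [j], incoming below it. Above [j]
   the vertices agree, so no literal arises there. *)
pose o : cube n := [ffun i => i == j].
have diffj : u j != v j by rewrite av // au // ffunE eqxx addbT; case: (a j).
exists (no_clash_clause u v o).
  apply/setUP; right; rewrite inE; apply/existsP; exists u.
  apply/existsP; exists v; apply/existsP; exists o; rewrite eqxx andbT.
  by apply: contraNneq diffj => ->.
apply/bigcupsP=> i; rewrite inE => diffi.
have [lti|] := ltnP i j.
  have ineqj : (i == j) = false by apply: contraTF lti => /eqP->; rewrite ltnn.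
  apply/subsetP=> l; rewrite /neq_lit ffunE ineqj !inE.
  by case/orP=> /eqP->; rewrite !imset_f ?inE ?orbT.
move=> lei; have [->|neqij] := eqVneq i j.
  by rewrite /neq_lit ffunE eqxx subsetUl.
by rewrite av // au // ffunE (negPf neqij) addbF eqxx in diffi.
Qed.

(** The falsity of [A] is what the search remembers on entering the face; the last hypothesis
    handles each sink [v] it may return. *)
Lemma sink_search k a A : k <= n -> #|A| + k * k.+1 <= W ->
  (forall v, in_face a k v ->
     subsumed W (sink_or_clash n) (A :|: low_clause v k)) ->
  subsumed W (sink_or_clash n) A.
Proof.
elim: k a A => [|k IHk] a A lekn leAW sinkA.
  by have := sinkA a (fun _ _ => erefl); rewrite low_clause0 setU0.
pose j := Ordinal lekn; have jE : k = j by [].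
have cardU (B : clause (soc_var n)) v : #|B :|: low_clause v k| <= #|B| + k.
  rewrite cardsU; have := card_low_clause v k; lia.
(* The allowance grows by [2(k+1)] from level [k] to [k+1]: each of [v] and [u] costs [k] literals
   below [j] and one at [j]. *)
have leW : #|A| + k * k.+1 + k.+1.*2 <= W by lia.
move: (k * k.+1) leW IHk => K leW IHk.
apply: (IHk a) => [||v av]; [exact: ltnW | lia |].
have cardv := cardU A v.
apply: (@subsumed_resolve (soc_var n) _ _ _ ((v, j), true)); first lia.
  apply: subsumed_sub (sinkA v _); last by move=> i /ltnW; apply: av.
  by rewrite jE low_clauseS setUCA.
(* Falsifying [A'] also records that [v] is a sink of its facet whose edge in direction [j] is
   outgoing. *)
pose A' : clause (soc_var n) := ((v, j), false) |: (A :|: low_clause v k).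
have cardA' : #|A'| <= #|A| + k.+1.
  by rewrite cardsU1; case: (_ \notin _); lia.
apply: (IHk (flip a j) A') => [||u au]; [exact: ltnW | lia |].
have cardu := cardU A' u.
apply: (@subsumed_resolve (soc_var n) _ _ _ ((u, j), true)); first lia.
  apply: subsumed_sub (sinkA u _); last first.
    move=> i ltki; rewrite au 1?ltnW // ffunE.
    have /negPf-> : i != j by apply: contraTneq ltki => ->; rewrite ltnn.
    by rewrite addbF.
  rewrite jE low_clauseS setUCA; apply: setSU.
  by rewrite (subset_trans (subsetUl A (low_clause v k))) ?subsetUr.
(* Both facet sinks are now outgoing in direction [j]. *)
have [C FC sC] := @clash_sub a j u v av au.
apply: subsumed_axiom FC (subset_trans sC _).
apply/subsetP=> l; rewrite !inE /compl_lit /=.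
by case/orP=> /orP[] ->; rewrite ?orbT.
Qed.

End SinkSearch.

(** * The refutation of [sink_or_clash] and its bounds *)

Lemma empty_clause_notin_sink_or_clash n :
  0 < n -> set0 \notin sink_or_clash n.
Proof.
move=> n_gt0; rewrite inE negb_or; apply/andP; split.
  apply/negP=> /imsetP[u _ /setP/(_ ((u, Ordinal n_gt0), true))].
  by rewrite inE imset_f.
rewrite inE; apply/existsP=> -[u /existsP[v /existsP[o /andP[neq_uv /eqP]]]].
move/setP=> C0; case/eqP: neq_uv; apply/ffunP=> i.
apply: contrapT => /eqP diffi.
have := C0 (neq_lit u i (o i)); rewrite inE => /esym/bigcupP[].
by exists i; rewrite !inE ?eqxx.
Qed.

Lemma sink_or_clash_proof n : 0 < n ->
  exists2 P, resolution_proof (sink_or_clash n) P &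
    0 < proof_size P <= 2 ^ (3 * n * (n * n.+1)) /\ proof_width P <= n * n.+1.
Proof.
move=> n_gt0; pose W := n * n.+1.
have [C] : subsumed W (sink_or_clash n) set0.
  (* For [k = n] the face is the whole cube, whatever its base vertex, and a sink found falsifies an
     axiom. *)
  apply: (@sink_search _ _ n [ffun=> false]); rewrite ?cards0 // => v _.
  rewrite set0U low_clause_no_sink; apply: subsumed_axiom (subxx _).
  by apply/setUP; left; apply: imset_f.
rewrite subset0 => /eqP->.
case/(short_resolution_proof (empty_clause_notin_sink_or_clash n_gt0)) => P.
move=> proofP [sizeP widthP]; exists P => //; split=> //; apply/andP; split.
  by case: proofP => _ [P' [st [-> _]]]; rewrite /proof_size size_rcons.
apply: leq_trans sizeP _.
apply: leq_trans (subset_leq_card (subsetDl _ _)) _.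
apply: leq_trans (card_narrow_clauses _ _) _.
rewrite expnM leq_exp2r ?muln_gt0 ?n_gt0 //.
rewrite card_prod card_bool card_soc_var.
(* With [t = 2 ^ n > n] there are [2nt] literals, and [2nt + 1 <= t ^ 3]. *)
have lt_n := ltn_expl n (ltnSn 1); rewrite [3 * n]mulnC expnM.
by move: (2 ^ n) lt_n => t lt_nt; rewrite !expnS expn0 muln1; nia.
Qed.

(** * Logarithms and the polylogarithmic bound *)

Local Open Scope ring_scope.

Lemma log2_le (R : realType) (x y : R) : 0 < x -> x <= y -> log2 x <= log2 y.
Proof.
move=> x_gt0 le_xy; rewrite ler_pM2r ?invr_gt0 ?ln_gt0 ?ltr1n //.
by rewrite ler_ln // posrE (lt_le_trans x_gt0).
Qed.

Lemma log2_exp2 (R : realType) m : log2 (2 ^ m)%:R = m%:R :> R.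
Proof.
rewrite /log2 natrX lnXn ?ltr0n // -[_ *+ _]mulr_natl mulfK //.
by rewrite gt_eqF // ln_gt0 ?ltr1n.
Qed.

Local Close Scope ring_scope.

Theorem corollary38 (R : realType) :
  exists P : forall n : nat, seq (step (soc_var n)),
    (forall n : nat, 1 <= n -> resolution_proof (sink_or_clash n) (P n)) /\
    efficient R P.
Proof.
have ex_proof n : exists P, 0 < n ->
    [/\ resolution_proof (sink_or_clash n) P,
        0 < proof_size P <= 2 ^ (3 * n * (n * n.+1))
      & proof_width P <= n * n.+1].
  case: n => [|n]; first by exists [::].
  by have [//|P proofP [sizeP widthP]] := @sink_or_clash_proof n.+1; exists P.
pose P n := sval (cid (ex_proof n)).
exists P; split=> [n n_gt0|]; first by have [] := svalP (cid (ex_proof n)) n_gt0.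
(* At [n] this polynomial equals [3n * n(n+1) + n(n+1)], the bound on log-size plus width; it
   increases on nonnegative reals, and [n <= log2 N] since [N = n * 2 ^ n]. *)
exists ('X * ('X + 1%:P) * (3%:R%:P * 'X + 1%:P))%R => n n_gt0.
have [_ /andP[size_gt0 sizeP] widthP] := svalP (cid (ex_proof n)) n_gt0.
rewrite card_soc_var -/(P n) in size_gt0 sizeP widthP *.
have le_n : (n%:R <= log2 (n * 2 ^ n)%:R :> R)%R.
  rewrite -[leLHS](log2_exp2 R) log2_le ?ltr0n ?expn_gt0 // ler_nat.
  exact: leq_pmull.
have le_size :
    (log2 (proof_size (P n))%:R <= (3 * n * (n * n.+1))%:R :> R)%R.
  by rewrite -[leRHS](log2_exp2 R) log2_le ?ltr0n // ler_nat.
have le_width : ((proof_width (P n))%:R <= (n * n.+1)%:R :> R)%R.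
  by rewrite ler_nat.
apply: (le_trans (lerD le_size le_width)).
rewrite !(hornerM, hornerD, hornerX, hornerC).
move: (log2 (n * _)%:R) le_n => L le_n.
have -> : ((3 * n * (n * n.+1))%:R + (n * n.+1)%:R
    = n%:R * (n%:R + 1) * (3%:R * n%:R + 1) :> R)%R.
  by rewrite -addn1 !natrM natrD; lra.
have n_ge0 : (0 <= n%:R :> R)%R by [].
by apply: ler_pM; [apply: mulr_ge0 | | apply: ler_pM |]; lra.
Qed.
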